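(* Let $X \sim P$, let $\{P_\theta : \theta \in \Theta\}$ be a model indexed by a countable set $\Theta$, let $\mathcal{L}:\Theta\to\mathbb{R}$ be a penalty, and let $\hat\theta$ be the penalized MLE over $\Theta$ with penalty $\mathcal{L}$. Then for any function $L:\Theta\to\mathbb{R}$, $$\mathbb{E}\, D_B(P, P_{\hat\theta}) \le \mathcal{R}_{\Theta,\mathcal{L}}(P) + 2\log \sum_{\theta\in\Theta} e^{-\frac12[\mathcal{L}(\theta)+L(\theta)]} + \mathbb{E}\, L(\hat\theta).$$
   Context: Lower-case letters denote densities: $p$ and $p_\theta$ are the densities of $P$ and $P_\theta$ with respect to a common dominating measure (Lebesgue or counting measure). The Hellinger affinity is $A(P,Q)=\int\sqrt{p(x)q(x)}\,dx$ (integral with respect to the dominating measure), the Bhattacharyya divergence is $D_B(P,Q)=2\log\frac{1}{A(P,Q)}$, and $D(P\|Q)$ is relative entropy. The penalized MLE $\hat\theta=\hat\theta(X)$ is a (random) parameter maximizing $\log p_\theta(X)-\mathcal{L}(\theta)$ over $\theta\in\Theta$; it is assumed that a maximizer exists for every possible data value (uniqueness is not required; any scheme for breaking ties may be used). The minimal expected redundancy is $\mathcal{R}_{\Theta,\mathcal{L}}(P)=\inf_{\theta\in\Theta}\{D(P\|P_\theta)+\mathcal{L}(\theta)\}$. Expectations are over $X\sim P$. The function $L$ may depend on $P$ but not on the data. *)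

(* Defs.v *)
From HB Require Import structures.
From mathcomp Require Import all_boot all_order all_algebra.
From mathcomp Require Import all_classical all_reals all_analysis.

Set Implicit Arguments.
Unset Strict Implicit.
Unset Printing Implicit Defensive.

Import Order.TTheory GRing.Theory Num.Theory.
Import numFieldNormedType.Exports.

Local Open Scope classical_set_scope.
Local Open Scope ring_scope.
Local Open Scope ereal_scope.

(* [mu] plays the role of the dominating measure; it is arbitrary, so Lebesgue
   and counting measures are both instances. *)
Definition is_density d (T : measurableType d) (R : realType)
    (mu : {measure set T -> \bar R}) (P : probability T R) (p : T -> R) : Prop :=
  [/\ measurable_fun setT p,
      (forall x, (0 <= p x)%R) &
      (forall A, measurable A -> P A = \int[mu]_(x in A) (p x)%:E)].

Definition hellinger_affinity d (T : measurableType d) (R : realType)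
    (mu : {measure set T -> \bar R}) (p q : T -> R) : \bar R :=
  \int[mu]_x (Num.sqrt (p x * q x))%:E.

(* [0^-1 = +oo] and [lne +oo = +oo], so the divergence is [+oo] when the
   affinity vanishes. *)
Definition bhattacharyya d (T : measurableType d) (R : realType)
    (mu : {measure set T -> \bar R}) (p q : T -> R) : \bar R :=
  2%:E * lne (1 / hellinger_affinity mu p q).

(* The extended operations give the integrand its usual conventions: it is [0]
   where [p x = 0], and [+oo] where [p x > 0 = q x]. *)
Definition relative_entropy d (T : measurableType d) (R : realType)
    (mu : {measure set T -> \bar R}) (p q : T -> R) : \bar R :=
  \int[mu]_x ((p x)%:E * lne ((p x)%:E / (q x)%:E)).

(* [lne 0 = -oo], so a parameter of zero likelihood is selected only when every
   parameter has zero likelihood. *)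
Definition is_penalized_MLE (T : Type) (R : realType) (Theta : Type)
    (ptheta : Theta -> T -> R) (pen : Theta -> R) (that : T -> Theta) : Prop :=
  forall x theta,
    lne (ptheta theta x)%:E - (pen theta)%:E <=
    lne (ptheta (that x) x)%:E - (pen (that x))%:E.

Definition minimal_expected_redundancy d (T : measurableType d) (R : realType)
    (mu : {measure set T -> \bar R}) (Theta : Type) (p : T -> R)
    (ptheta : Theta -> T -> R) (pen : Theta -> R) : \bar R :=
  ereal_inf (range (fun theta =>
    relative_entropy mu p (ptheta theta) + (pen theta)%:E)).

(* Addition for which [+oo + -oo = +oo] (the library's dual addition).  Used for
   the right-hand side of a bound, it makes the bound vacuous exactly where the
   right-hand side has a term [+oo], hence wherever it is an undefined
   [oo - oo]; elsewhere it is the ordinary sum. *)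
Notation "x +^ y" := (dual_adde x y)
  (at level 50, left associativity) : ereal_scope.

(* Main.v *)
Require Import Defs.
From HB Require Import structures.
From mathcomp Require Import all_boot all_order all_algebra.
From mathcomp Require Import all_classical all_reals all_analysis.
From mathcomp Require Import ring lra measurable_realfun.

Import Order.TTheory GRing.Theory Num.Theory.
Import numFieldNormedType.Exports.

Local Open Scope classical_set_scope.
Local Open Scope ring_scope.
Local Open Scope ereal_scope.

Set Implicit Arguments.
Unset Strict Implicit.
Unset Printing Implicit Defensive.

(** The bound compares every fixed parameter [theta0] with the selected one
    through the random weight
      [W = c / A * sqrt (q / p)],
    where [c = expR (- (pen + L) / 2)], [q] is the selected density and [A] is
    its affinity with [p].  For a fixed parameter the [P]-integral of
    [sqrt (q / p)] is exactly [A], so the weight of that parameter has integral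
    at most [c]; since the selected weight is one term of the sum of all
    weights, [W] has [P]-integral at most [S], the sum of the [c]
    ([integral_selected_ratio_le]).

    Taking logarithms in the definition of [W] expresses the divergence
    [- 2 * ln A] by [2 * ln W] and the penalized log-likelihood of the selected
    parameter, which is at least that of [theta0].  With the tangent line
    [ln (W / S) <= W / S - 1] in place of the inequality of Jensen, this reads
    pointwise
      [- 2 * ln A <= 2 * ln S + 2 * (W / S - 1) + ln (p / q0) + pen0 + L]
    ([log_affinity_bound]).  Integrating against [P], the term in [W] contributes
    at most [0] and [ln (p / q0)] contributes the relative entropy
    ([expected_bhattacharyya_le]); the infimum over [theta0] is the theorem.

    The same inequality settles the infinite cases.  Its left side is
    nonnegative, so the negative part of [L] at the selected parameter is
    dominated by an integrable function as soon as [S] and one relative entropy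
    are finite.  Hence the expectation of [L] is then either finite or [+oo],
    and cannot be an indeterminate difference of infinities. *)

(** * Selection from a countable family *)

Lemma measurable_selection (d d' : measure_display) (T : measurableType d)
    (U : measurableType d') (I : countType) (s : T -> I) (f : I -> T -> U) :
  (forall i, measurable (s @^-1` [set i])) ->
  (forall i, measurable_fun setT (f i)) ->
  measurable_fun setT (fun x => f (s x) x).
Proof.
move=> ms mf _ Y mY; rewrite setTI.
rewrite (_ : _ @^-1` _ = \bigcup_i (s @^-1` [set i] `&` f i @^-1` Y)).
  apply: countable_bigcupT_measurable; first exact: countableP.
  by move=> i; apply: measurableI => //; rewrite -[X in measurable X]setTI; exact: mf.
by apply/seteqP; split=> [x /= fY|x [i _ [/= <-]]//]; exists (s x).
Qed.

(** The selected term is bounded by the sum of all terms, and sum and integral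
    of nonnegative functions commute.  The family is enumerated by
    [pickle_inv] rather than [unpickle] because [pickle_inv n] is [Some i] for
    the single code [n] of [i], so that no index is counted twice. *)
Lemma integral_selection_le (d : measure_display) (T : measurableType d)
    (R : realType) (mu : {measure set T -> \bar R}) (I : countType)
    (s : T -> I) (f : I -> T -> \bar R) :
  (forall i, measurable (s @^-1` [set i])) ->
  (forall i, measurable_fun setT (f i)) ->
  (forall i x, 0 <= f i x) ->
  \int[mu]_x f (s x) x <= \esum_(i in [set: I]) \int[mu]_x f i x.
Proof.
move=> ms mf f0.
pose g n x := if pickle_inv n is Some i then f i x else 0.
have g0 n x : 0 <= g n x by rewrite /g; case: pickle_inv.
have mg n : measurable_fun setT (g n).
  by rewrite /g; case: pickle_inv => [i|]; [exact: mf|exact: measurable_cst].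
have -> : \esum_(i in [set: I]) \int[mu]_x f i x =
    \sum_(n <oo) \int[mu]_x g n x.
  rewrite nneseries_esumT; last by move=> n; exact: integral_ge0.
  transitivity (\esum_(n in (@pickle I) @` setT) \int[mu]_x g n x).
    rewrite esum_image; last by move=> i j _ _; exact: (pcan_inj pickleK_inv).
    by apply: eq_esum => i _; rewrite /g pickleK_inv.
  rewrite esum_mkcond; apply: eq_esum => n _; case: ifPn => // /negP nI.
  apply/esym/integral0_eq => x _; rewrite /g.
  move: (@pickle_invK I n); case: pickle_inv => [i|]//= iE.
  by case: nI; rewrite inE; exists i.
rewrite -integral_nneseries//.
apply: ge0_le_integral => //.
- exact: measurable_selection.
- exact: ge0_emeasurable_sum.
- move=> x _; rewrite (nneseriesD1 (n := pickle (s x)))//.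
  rewrite {1}/g pickleK_inv leeDl//; exact: nneseries_ge0.
Qed.

(** * Integration against a probability with a density *)

Section density.
Import HBNNSimple.

(** Monotone approximation by simple functions, for which the identity is the
    definition of a density. *)
Lemma ge0_integral_density (d : measure_display) (T : measurableType d)
    (R : realType) (mu : {measure set T -> \bar R}) (P : probability T R)
    (p : T -> R) (f : T -> \bar R) :
  is_density mu P p -> measurable_fun setT f -> (forall x, 0 <= f x) ->
  \int[P]_x f x = \int[mu]_x (f x * (p x)%:E).
Proof.
move=> [mp p0 Pp] mf f0.
have simple (h : {nnsfun T >-> R}) :
    \int[P]_x (h x)%:E = \int[mu]_x ((h x)%:E * (p x)%:E).
  rewrite integralT_nnsfun sintegralE.
  transitivity (\int[mu]_x (\sum_(r \in range h)
      (r * \1_(h @^-1` [set r]) x)%:E * (p x)%:E)).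
    rewrite ge0_integral_fsum//; last 2 first.
    - move=> r; apply/emeasurable_funM; last exact/measurable_EFinP.
      exact/measurable_EFinP/measurable_funM.
    - by move=> r x _; apply: mule_ge0; [exact: nnfun_muleindic_ge0|rewrite lee_fin].
    apply: eq_fsbigr => r; rewrite inE => -[x _ <-].
    under eq_integral do rewrite EFinM -muleA.
    rewrite ge0_integralZl_EFin//; last 2 first.
    - by move=> y _; rewrite mule_ge0 ?lee_fin.
    - apply/emeasurable_funM; last exact/measurable_EFinP.
      exact/measurable_EFinP/measurable_indic.
    congr (_ * _); apply: etrans (Pp _ _) _ => //; rewrite integral_mkcond.
    by apply: eq_integral => y _; rewrite epatch_indic muleC.
  apply: eq_integral => x _.
  rewrite -ge0_mule_fsuml => [|r]; last exact: nnfun_muleindic_ge0.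
  by rewrite fsumEFin// -fimfunE.
pose h := nnsfun_approx measurableT mf.
have hf x : EFin \o h^~ x @ \oo --> f x by exact: cvg_nnsfun_approx.
have nd x : {homo (fun n => (h n x)%:E) : m n / (m <= n)%N >-> m <= n}.
  by move=> m n mn; rewrite lee_fin; exact/lefP/nd_nnsfun_approx.
transitivity (limn (fun n => \int[P]_x (h n x)%:E)).
  rewrite -monotone_convergence//.
  - by apply: eq_integral => x _; apply/esym/cvg_lim => //; exact: hf.
  - by move=> n; exact/measurable_EFinP.
  - by move=> n x _; rewrite lee_fin.
under eq_fun do rewrite simple.
rewrite -monotone_convergence//.
- apply: eq_integral => x _; apply/cvg_lim => //.
  by apply: cvgeZr => //; exact: hf.
- by move=> n; apply/emeasurable_funM; exact/measurable_EFinP.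
- by move=> n x _; rewrite mule_ge0 ?lee_fin.
- by move=> x _ m n mn; rewrite lee_wpmul2r ?lee_fin//; exact: nd.
Qed.

End density.

Lemma integral_density (d : measure_display) (T : measurableType d)
    (R : realType) (mu : {measure set T -> \bar R}) (P : probability T R)
    (p f : T -> R) :
  is_density mu P p -> measurable_fun setT f ->
  mu.-integrable setT (fun x => (f x * p x)%:E) ->
  P.-integrable setT (EFin \o f) /\
  \int[P]_x (f x)%:E = \int[mu]_x (f x * p x)%:E.
Proof.
move=> Pp mf /integrableP[mfp fp_lty].
have [mp p0 _] := Pp.
have mf' : measurable_fun setT (EFin \o f) by exact/measurable_EFinP.
split.
  apply/integrableP; split=> //.
  rewrite (ge0_integral_density Pp)//; last exact: measurableT_comp.
  apply: le_lt_trans fp_lty; rewrite le_eqVlt; apply/orP; left; apply/eqP.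
  apply: eq_integral => x _; rewrite EFinM abseM; congr (_ * _).
  by rewrite gee0_abs ?lee_fin.
rewrite [LHS]integralE [RHS]integralE; congr (_ - _);
  rewrite (ge0_integral_density Pp)//.
- apply: eq_integral => x _.
  by rewrite !funeposE EFinM maxe_pMl ?lee_fin// mul0e.
- exact: measurable_funepos.
- apply: eq_integral => x _.
  by rewrite !funenegE EFinM -muleN maxe_pMl ?lee_fin// mul0e mulNe muleN.
- exact: measurable_funeneg.
Qed.

(** A [mu]-null set is [P]-null, and so is the zero set of [p].  Hence a property
    only has to be checked [mu]-almost everywhere where [p] does not vanish;
    positivity of [p] comes for free. *)
Lemma ae_density (d : measure_display) (T : measurableType d)
    (R : realType) (mu : {measure set T -> \bar R}) (P : probability T R)
    (p : T -> R) (Q : T -> Prop) :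
  is_density mu P p -> {ae mu, forall x, p x != 0%R -> Q x} ->
  {ae P, forall x, (0 < p x)%R /\ Q x}.
Proof.
move=> Pp [N [mN N0 NQ]]; have [mp p0 PE] := Pp.
have mpE : measurable_fun setT (EFin \o p) by exact/measurable_EFinP.
have mZ : measurable [set x | p x = 0%R].
  rewrite [X in measurable X](_ : _ = setT `&` p @^-1` [set 0%R]); last first.
    by rewrite setTI.
  exact: mp.
exists (N `|` [set x | p x = 0%R]); split; first exact: measurableU.
  apply: null_set_setU => //; apply: etrans (PE _ _) _ => //.
  - by apply: null_set_integral => //; exact: measurable_funTS.
  - by apply: integral0_eq => x /= ->.
move=> x /= /not_andP nQ; have [->|px0] := eqVneq (p x) 0%R; [by right|left].
apply: NQ => /= Qx; case: nQ; first by rewrite lt_neqAle eq_sym px0 p0.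
by apply; exact: Qx.
Qed.

(** * Hellinger affinity and Bhattacharyya divergence *)

Lemma measurable_sqrt (d : measure_display) (T : measurableType d)
    (R : realType) (f : T -> R) :
  (forall x, 0 <= f x)%R -> measurable_fun setT f ->
  measurable_fun setT (fun x => Num.sqrt (f x)).
Proof.
move=> f0 mf; under eq_fun do rewrite -powR12_sqrt//.
exact: (measurableT_comp (measurable_powR _)).
Qed.

Lemma measurable_density_ratio (d : measure_display) (T : measurableType d)
    (R : realType) (p q : T -> R) :
  (forall x, 0 <= q x)%R -> measurable_fun setT p -> measurable_fun setT q ->
  measurable_fun setT (fun x => p x / q x)%R.
Proof.
move=> q0 mp mq; apply: measurable_funM => //.
under eq_fun do rewrite -powR_inv1//.
exact: (measurableT_comp (measurable_powR _)).
Qed.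

Lemma integral_density1 (d : measure_display) (T : measurableType d)
    (R : realType) (mu : {measure set T -> \bar R}) (P : probability T R)
    (p : T -> R) :
  is_density mu P p -> \int[mu]_x (p x)%:E = 1.
Proof. by move=> [_ _ PE]; rewrite -PE// probability_setT. Qed.

Lemma hellinger_affinity_ge0 (d : measure_display) (T : measurableType d)
    (R : realType) (mu : {measure set T -> \bar R}) (p q : T -> R) :
  0 <= hellinger_affinity mu p q.
Proof. by apply: integral_ge0 => x _; rewrite lee_fin sqrtr_ge0. Qed.

(** The geometric mean of [p] and [q] is at most their arithmetic mean, which has
    integral [1]. *)
Lemma hellinger_affinity_le1 (d : measure_display) (T : measurableType d)
    (R : realType) (mu : {measure set T -> \bar R}) (P Q : probability T R)
    (p q : T -> R) :
  is_density mu P p -> is_density mu Q q -> hellinger_affinity mu p q <= 1.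
Proof.
move=> Pp Qq; have [mp p0 _] := Pp; have [mq q0 _] := Qq.
have -> : 1 = \int[mu]_x (2^-1%:E * ((p x)%:E + (q x)%:E)) :> \bar R.
  have mpq : measurable_fun setT (fun x => (p x)%:E + (q x)%:E).
    by apply: emeasurable_funD; exact/measurable_EFinP.
  rewrite ge0_integralZl_EFin//; last first.
    by move=> x _; rewrite adde_ge0 ?lee_fin.
  have mpE : measurable_fun setT (EFin \o p) by exact/measurable_EFinP.
  have mqE : measurable_fun setT (EFin \o q) by exact/measurable_EFinP.
  rewrite ge0_integralD//; try by move=> x _; rewrite lee_fin.
  rewrite (integral_density1 Pp) (integral_density1 Qq).
  by rewrite -EFinD -EFinM; congr EFin; field.
apply: ge0_le_integral => //.
- apply/measurable_EFinP/measurable_sqrt; last exact: measurable_funM.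
  by move=> x; exact: mulr_ge0.
- apply: measurable_funeM.
  by apply: emeasurable_funD; exact/measurable_EFinP.
- move=> x _; rewrite -EFinD -EFinM lee_fin.
  rewrite sqrtrM//.
  have := sqr_ge0 (Num.sqrt (p x) - Num.sqrt (q x)).
  rewrite sqrrB !sqr_sqrtr// => h; lra.
Qed.

Lemma hellinger_affinity_fin_num (d : measure_display) (T : measurableType d)
    (R : realType) (mu : {measure set T -> \bar R}) (P Q : probability T R)
    (p q : T -> R) :
  is_density mu P p -> is_density mu Q q ->
  hellinger_affinity mu p q \is a fin_num.
Proof.
move=> Pp Qq; rewrite ge0_fin_numE ?hellinger_affinity_ge0//.
exact: le_lt_trans (hellinger_affinity_le1 Pp Qq) (ltry _).
Qed.

(** The divergence is [+oo] at a parameter of zero affinity; such a parameter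
    almost surely has zero likelihood, hence is not selected when some parameter
    has positive likelihood. *)
Lemma hellinger_affinity_eq0_ae (d : measure_display) (T : measurableType d)
    (R : realType) (mu : {measure set T -> \bar R}) (P : probability T R)
    (p q : T -> R) :
  is_density mu P p -> measurable_fun setT q -> (forall x, 0 <= q x)%R ->
  hellinger_affinity mu p q = 0 -> {ae P, forall x, q x = 0%R}.
Proof.
move=> Pp mq q0 A0; have [mp p0 _] := Pp.
suff : {ae P, forall x, (0 < p x)%R /\ q x = 0%R} by apply: filterS => x [].
apply: (ae_density Pp).
have : ae_eq mu setT (fun x => (Num.sqrt (p x * q x))%:E) (cst 0).
  apply/ae_eq_integral_abs => //.
    apply/measurable_EFinP/measurable_sqrt; last exact: measurable_funM.
    by move=> x; exact: mulr_ge0.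
  rewrite -[RHS]A0; apply: eq_integral => x _.
  by rewrite gee0_abs// lee_fin sqrtr_ge0.
apply: filterS => x /(_ I) /= [] /eqP.
rewrite sqrtr_eq0 => pq0 px0.
have px : (0 < p x)%R by rewrite lt_neqAle eq_sym px0 p0.
by apply/eqP; rewrite eq_le q0 andbT -(pmulr_rle0 _ px).
Qed.

Lemma bhattacharyya_ge0 (d : measure_display) (T : measurableType d)
    (R : realType) (mu : {measure set T -> \bar R}) (P Q : probability T R)
    (p q : T -> R) :
  is_density mu P p -> is_density mu Q q -> 0 <= bhattacharyya mu p q.
Proof.
move=> Pp Qq; rewrite /bhattacharyya mule_ge0// lne_ge0 mul1e.
have := hellinger_affinity_le1 Pp Qq.
have := hellinger_affinity_ge0 mu p q.
have := hellinger_affinity_fin_num Pp Qq.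
case: hellinger_affinity => // a _; rewrite !lee_fin => a0 a1.
rewrite inver; case: eqP => [_|/eqP an0]; first exact: leey.
by rewrite lee_fin invf_ge1// lt_neqAle eq_sym an0.
Qed.

Lemma bhattacharyyaE (d : measure_display) (T : measurableType d)
    (R : realType) (mu : {measure set T -> \bar R}) (p q : T -> R) :
  hellinger_affinity mu p q \is a fin_num ->
  hellinger_affinity mu p q != 0 ->
  bhattacharyya mu p q = (- 2 * ln (fine (hellinger_affinity mu p q)))%:E.
Proof.
have := hellinger_affinity_ge0 mu p q; rewrite /bhattacharyya mul1e.
case: (hellinger_affinity mu p q) => [a| |]//=; rewrite lee_fin eqe => a0 _ an0.
have apos : (0 < a)%R by rewrite lt_neqAle eq_sym an0.
rewrite inver gt_eqF// lne_EFin ?invr_gt0// lnV//.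
by rewrite -EFinM mulrN mulNr.
Qed.

(** * Finite relative entropy *)

(** The real formula is wrong only at [b = 0 < a], where the integrand is [+oo];
    for [a = 0] both sides vanish, since [0 * -oo = 0]. *)
Lemma relative_entropy_integrandE (R : realType) (a b : R) :
  (0 <= a)%R -> (0 <= b)%R ->
  a%:E * lne (a%:E / b%:E) =
  if b == 0%R then (if a == 0%R then 0 else +oo) else (a * ln (a / b))%:E.
Proof.
move=> a0 b0; have [->|b_neq0] := eqVneq b 0%R.
  have [->|a_neq0] := eqVneq a 0%R; first by rewrite mul0e.
  have apos : (0 < a)%R by rewrite lt_neqAle eq_sym a_neq0.
  by rewrite inve0 gt0_muley ?lte_fin//= gt0_muley ?lte_fin.
have [->|a_neq0] := eqVneq a 0%R; first by rewrite mul0e mul0r.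
rewrite inver (negbTE b_neq0) -EFinM lne_EFin ?EFinM//.
by rewrite divr_gt0// lt_neqAle eq_sym ?a_neq0 ?b_neq0.
Qed.

(** An integral is the difference of those of the positive and negative parts;
    when the latter is finite, so is the former. *)
Lemma integral_lty_integrable (d : measure_display) (T : measurableType d)
    (R : realType) (mu : {measure set T -> \bar R}) (f : T -> \bar R) :
  measurable_fun setT f -> \int[mu]_x f^\- x < +oo -> \int[mu]_x f x < +oo ->
  mu.-integrable setT f.
Proof.
move=> mf fn fy.
have fn_fin : \int[mu]_x f^\- x \is a fin_num.
  by rewrite ge0_fin_numE//; exact: integral_ge0.
have fp : \int[mu]_x f^\+ x < +oo.
  move: fy; rewrite integralE; move: fn_fin.
  case: (integral _ _ f^\-) => // r _.
  by case: (integral _ _ f^\+) => [u _| |] //; rewrite ltry.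
apply/integrableP; split=> //; rewrite -/(abse \o f) fune_abse.
rewrite ge0_integralD//; [|exact: measurable_funepos|exact: measurable_funeneg].
exact: lte_add_pinfty.
Qed.

(** By [ln t >= 1 - 1 / t] the integrand is at least [p - q >= - q], so its
    negative part has integral at most [1].  A relative entropy below [+oo] is
    therefore the integral of an integrable function.  The integrand is then
    finite almost everywhere, that is, [q] is positive where [p] is, and the
    integral can be rewritten as an expectation of the real logarithm. *)
Lemma relative_entropy_density (d : measure_display) (T : measurableType d)
    (R : realType) (mu : {measure set T -> \bar R}) (P Q : probability T R)
    (p q : T -> R) :
  is_density mu P p -> is_density mu Q q -> relative_entropy mu p q < +oo ->
  [/\ {ae P, forall x, (0 < p x)%R /\ (0 < q x)%R},
      P.-integrable setT (fun x => (ln (p x / q x))%:E) &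
      \int[P]_x (ln (p x / q x))%:E = relative_entropy mu p q].
Proof.
move=> Pp Qq; rewrite /relative_entropy; have [mp p0 _] := Pp.
have [mq q0 _] := Qq.
pose g x := if q x == 0%R then (if p x == 0%R then 0 else +oo)
            else (p x * ln (p x / q x))%:E.
rewrite (_ : (fun _ => _) = g); last first.
  by apply/funext => x; rewrite relative_entropy_integrandE.
move=> gy.
have ml : measurable_fun setT (fun x => ln (p x / q x)).
  apply: measurableT_comp; first exact: measurable_ln.
  exact: measurable_density_ratio.
have mg : measurable_fun setT g.
  apply: measurable_fun_ifT.
  - by apply: measurable_fun_eqr => //; exact: measurable_cst.
  - apply: measurable_fun_ifT; [|exact: measurable_cst..].
    by apply: measurable_fun_eqr => //; exact: measurable_cst.
  - exact/measurable_EFinP/measurable_funM.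
have gn : \int[mu]_x g^\- x <= 1.
  rewrite -(integral_density1 Qq); apply: ge0_le_integral => //.
  - exact: measurable_funeneg.
  - exact/measurable_EFinP.
  - move=> x _; rewrite funenegE /g; have [->|qx] := eqVneq (q x) 0%R.
      by case: ifP => _; rewrite ge_max ?oppe0/= ?leNye lexx.
    rewrite ge_max !lee_fin q0 andbT.
    have [->|px] := eqVneq (p x) 0%R; first by rewrite mul0r oppr0.
    have qx0 : (0 < q x)%R by rewrite lt_neqAle eq_sym qx q0.
    have px0 : (0 < p x)%R by rewrite lt_neqAle eq_sym px p0.
    rewrite -invf_div lnV ?posrE ?divr_gt0// mulrN opprK.
    have := @le_ln1Dx _ (q x / p x - 1)%R.
    rewrite addrCA subrr addr0 => /(_ _)/(ler_wpM2l (p0 x)).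
    rewrite mulrBr mulr1 mulrCA divff// mulr1 => h.
    apply: le_trans (h _) _; last by rewrite gerBl.
    by rewrite ltrBrDr addNr divr_gt0.
have ig : mu.-integrable setT g.
  by apply: integral_lty_integrable => //; exact: le_lt_trans gn (ltry _).
have gfin := integrable_ae measurableT ig.
have gE : ae_eq mu setT g (fun x => (ln (p x / q x) * p x)%:E).
  apply: filterS gfin => x /(_ I); rewrite /g => + _.
  case: ifPn => _; last by rewrite mulrC.
  by case: eqP => // -> _; rewrite mulr0.
have mlp : measurable_fun setT (fun x => (ln (p x / q x) * p x)%:E).
  exact/measurable_EFinP/measurable_funM.
have [il lE] : P.-integrable setT (EFin \o (fun x => ln (p x / q x))) /\
    \int[P]_x (ln (p x / q x))%:E = \int[mu]_x (ln (p x / q x) * p x)%:E.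
  apply: integral_density => //.
  apply/integrableP; split=> //.
  have /integrableP[_] := ig.
  rewrite (ae_eq_integral (abse \o (fun x => (ln (p x / q x) * p x)%:E)))//.
  - exact: measurableT_comp.
  - exact: measurableT_comp.
  - exact: ae_eq_abse.
split=> //; last by rewrite lE; apply/esym/ae_eq_integral.
apply: (ae_density Pp); apply: filterS gfin => x /(_ I); rewrite /g.
by case: eqP => [_|/eqP qx _ _]; [case: eqP|rewrite lt_neqAle eq_sym qx q0].
Qed.

(** * The weight of the selected parameter *)

(** [p * sqrt (q / p) = sqrt (p * q)], also where [p] vanishes. *)
Lemma integral_sqrt_density_ratio (d : measure_display) (T : measurableType d)
    (R : realType) (mu : {measure set T -> \bar R}) (P : probability T R)
    (p q : T -> R) :
  is_density mu P p -> measurable_fun setT q -> (forall x, 0 <= q x)%R ->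
  \int[P]_x (Num.sqrt (q x / p x))%:E = hellinger_affinity mu p q.
Proof.
move=> Pp mq q0; have [mp p0 _] := Pp.
rewrite (ge0_integral_density Pp)//; last first.
  apply/measurable_EFinP; apply: measurable_sqrt => [x|].
    exact: divr_ge0.
  exact: measurable_density_ratio.
apply: eq_integral => x _; rewrite -EFinM; congr EFin.
have [->|px] := eqVneq (p x) 0%R; first by rewrite mulr0 mul0r sqrtr0.
rewrite -[X in (_ * X)%R](ger0_norm (p0 x)) -sqrtr_sqr -sqrtrM ?divr_ge0//.
by congr Num.sqrt; rewrite expr2 mulrA divfK// mulrC.
Qed.

(** Each term is normalized by its affinity, so that its integral is [c i], or
    [0] when the affinity vanishes, as then [c i / 0 = 0]. *)
Lemma integral_selected_ratio_le (d : measure_display) (T : measurableType d)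
    (R : realType) (mu : {measure set T -> \bar R}) (P : probability T R)
    (p : T -> R) (I : countType) (Q : I -> probability T R) (q : I -> T -> R)
    (s : T -> I) (c : I -> R) :
  is_density mu P p -> (forall i, is_density mu (Q i) (q i)) ->
  (forall i, measurable (s @^-1` [set i])) -> (forall i, 0 <= c i)%R ->
  \int[P]_x (c (s x) / fine (hellinger_affinity mu p (q (s x)))
             * Num.sqrt (q (s x) x / p x))%:E
  <= \esum_(i in [set: I]) (c i)%:E.
Proof.
move=> Pp Qq ms c0; have [mp p0 _] := Pp.
pose A i := fine (hellinger_affinity mu p (q i)).
have A0 i : (0 <= A i)%R by rewrite fine_ge0// hellinger_affinity_ge0.
have mq i : measurable_fun setT (q i) by have [] := Qq i.
have q0 i x : (0 <= q i x)%R by have [_ + _] := Qq i; exact.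
have mr i : measurable_fun setT (fun x => Num.sqrt (q i x / p x)).
  apply: measurable_sqrt; last exact: measurable_density_ratio.
  by move=> x; exact: divr_ge0.
pose f i x := (c i / A i * Num.sqrt (q i x / p x))%:E.
apply: (@le_trans _ _ (\esum_(i in [set: I]) \int[P]_x f i x)).
  apply: (@integral_selection_le _ _ _ P _ _ f) => //.
  - by move=> i; exact/measurable_EFinP/measurable_funM.
  - by move=> i x; rewrite lee_fin mulr_ge0// ?divr_ge0// sqrtr_ge0.
apply: le_esum => i _; rewrite /f; under eq_integral do rewrite EFinM.
rewrite ge0_integralZl_EFin//; last 2 first.
- exact/measurable_EFinP.
- exact: divr_ge0.
rewrite (integral_sqrt_density_ratio Pp)//.
rewrite -[X in _ * X]fineK ?(hellinger_affinity_fin_num Pp (Qq i))//.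
rewrite -/(A i) -EFinM lee_fin.
have [->|Ai] := eqVneq (A i) 0%R; first by rewrite mulr0.
by rewrite divfK.
Qed.

(** The tangent line of the logarithm at [1] bounds [ln (W / S)] by [W / S - 1],
    where [W] is the weight [expR (- (l + L) / 2) / a * sqrt (q / p)]; expanding
    [ln W] and replacing [ln q - l] by the smaller [ln q0 - l0] leaves the
    claim. *)
Lemma log_affinity_bound (R : realType) (S a p q q0 l l0 L : R) :
  (0 < S)%R -> (0 < a)%R -> (0 < p)%R -> (0 < q)%R -> (0 < q0)%R ->
  (ln q0 - l0 <= ln q - l)%R ->
  (- 2 * ln a <=
   2 * ln S + 2 * (expR (- (1 / 2) * (l + L)) / a * Num.sqrt (q / p) / S - 1)
   + ln (p / q0) + l0 + L)%R.
Proof.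
move=> S0 a0 p0 qpos q00 mle.
set W := (expR _ / a * Num.sqrt (q / p))%R.
have r0 : (0 < q / p)%R by rewrite divr_gt0.
have W0 : (0 < W)%R by rewrite mulr_gt0 ?divr_gt0 ?expR_gt0 ?sqrtr_gt0.
have lnW : ln W = (- (1 / 2) * (l + L) - ln a + (ln q - ln p) / 2)%R.
  rewrite /W lnM ?posrE ?divr_gt0 ?expR_gt0 ?sqrtr_gt0//.
  rewrite ln_div ?posrE ?expR_gt0// expRK.
  rewrite -powR12_sqrt ?ltW// ln_powR ln_div ?posrE// mulrC; congr (_ + _)%R.
  by rewrite mulrC.
have : (ln (W / S) <= W / S - 1)%R.
  have := @le_ln1Dx _ (W / S - 1)%R; rewrite addrCA subrr addr0; apply.
  by rewrite ltrBrDr addNr divr_gt0.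
rewrite !ln_div ?posrE// lnW => h; lra.
Qed.

(** * Expected divergence of the penalized maximum likelihood estimator *)

Lemma esum_expR_gt0 (R : realType) (I : choiceType) (u : I -> R) (i : I) :
  0 < \esum_(j in [set: I]) (expR (u j))%:E.
Proof.
apply: (@lt_le_trans _ _ (expR (u i))%:E); first by rewrite lte_fin expR_gt0.
apply: esum_ge; exists [set i]; last by rewrite fsbig_set1.
by split; [exact: finite_set1|].
Qed.

(** The integral of [log_affinity_bound].  The hypothesis on [L] includes the
    integral [-oo], which is also the value of a difference of infinities.  The
    divergence is nonnegative, so the pointwise bound dominates the negative part
    of [L] at the selected parameter; this excludes both cases and makes the
    integrability of [L] a conclusion. *)
Lemma expected_bhattacharyya_le (d : measure_display) (T : measurableType d)
    (R : realType) (mu : {measure set T -> \bar R}) (P : probability T R)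
    (p : T -> R) (Theta : countType) (Ptheta : Theta -> probability T R)
    (ptheta : Theta -> T -> R) (pen : Theta -> R) (that : T -> Theta)
    (L : Theta -> R) (S : R) (theta0 : Theta) :
  is_density mu P p ->
  (forall theta, is_density mu (Ptheta theta) (ptheta theta)) ->
  (forall theta, measurable (that @^-1` [set theta])) ->
  is_penalized_MLE ptheta pen that ->
  \esum_(theta in [set: Theta]) (expR (- (1 / 2) * (pen theta + L theta)))%:E
    = S%:E ->
  \int[P]_x (L (that x))%:E < +oo ->
  relative_entropy mu p (ptheta theta0) < +oo ->
  P.-integrable setT (fun x => (L (that x))%:E) /\
  \int[P]_x bhattacharyya mu p (ptheta (that x)) <=
    relative_entropy mu p (ptheta theta0) + (pen theta0)%:E + (2 * ln S)%:E
    + \int[P]_x (L (that x))%:E.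
Proof.
move=> Pp Qq mthat mle SE Ly Dy; have [mp p0 _] := Pp.
pose c theta := expR (- (1 / 2) * (pen theta + L theta)).
pose A theta := fine (hellinger_affinity mu p (ptheta theta)).
have Afin theta := hellinger_affinity_fin_num Pp (Qq theta).
have A0 theta : (0 <= A theta)%R by rewrite fine_ge0// hellinger_affinity_ge0.
have mq theta : measurable_fun setT (ptheta theta) by have [] := Qq theta.
have q0 theta x : (0 <= ptheta theta x)%R by have [_ + _] := Qq theta; exact.
have S0 : (0 < S)%R.
  by rewrite -lte_fin -SE; apply: esum_expR_gt0.
pose W x := (c (that x) / A (that x) *
  Num.sqrt (ptheta (that x) x / p x))%R.
have W0 x : (0 <= W x)%R.
  by rewrite mulr_ge0 ?sqrtr_ge0// divr_ge0// expR_ge0.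
have mW : measurable_fun setT W.
  apply: (measurable_selection
    (f := fun theta x => (c theta / A theta * Num.sqrt (ptheta theta x / p x))%R))
    => // theta.
  apply: measurable_funM => //; apply: measurable_sqrt => [x|].
    exact: divr_ge0.
  exact: measurable_density_ratio.
have intW : \int[P]_x (W x)%:E <= S%:E.
  rewrite -SE; apply: (integral_selected_ratio_le Pp Qq mthat) => theta.
  exact: expR_ge0.
have iW : P.-integrable setT (EFin \o W).
  apply/integrableP; split; first exact/measurable_EFinP.
  under eq_integral do rewrite /= ger0_norm//.
  exact: le_lt_trans intW (ltry _).
have [pos_ae il lE] := relative_entropy_density Pp (Qq theta0) Dy.
(* [K] is the bound of the pointwise inequality without its last term [L]; [k]
   collects the constants. *)
pose k : R := (2 * ln S - 2 + pen theta0)%R.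
pose K x := k%:E + ((2 / S)%:E * (W x)%:E + (ln (p x / ptheta theta0 x))%:E).
have iWl : P.-integrable setT
    (fun x => (2 / S)%:E * (W x)%:E + (ln (p x / ptheta theta0 x))%:E).
  by apply: integrableD => //; exact: integrableZl.
have ik : P.-integrable setT (cst k%:E).
  exact: finite_measure_integrable_cst.
have iK : P.-integrable setT K by exact: integrableD.
have intK : \int[P]_x K x <=
    relative_entropy mu p (ptheta theta0) + (pen theta0)%:E + (2 * ln S)%:E.
  rewrite /K (integralD _ ik iWl)//.
  have -> : \int[P]_x cst k%:E x = k%:E.
    by rewrite integral_cst// [X in _ * X]probability_setT mule1.
  rewrite integralD//; last exact: integrableZl.
  rewrite integralZl//; move: intW lE.
  have := integrable_fin_num measurableT iW.
  have := integrable_fin_num measurableT il.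
  rewrite /=; case: (\int[P]_x (ln (p x / ptheta theta0 x))%:E) => //= D _.
  case: (\int[P]_x (W x)%:E) => //= w _; rewrite lee_fin => wS <-.
  rewrite -EFinM -!EFinD lee_fin /k.
  have : (2 / S * w <= 2)%R by rewrite mulrAC ler_pdivrMr// ler_pM2l.
  by move=> h; lra.
have zero_ae : {ae P, forall x theta, A theta = 0%R -> ptheta theta x = 0%R}.
  have : {ae P, forall x n, if @pickle_inv Theta n is Some theta then
      (A theta = 0%R -> ptheta theta x = 0%R) else True}.
    apply: ae_foralln => n; case: pickle_inv => [theta|]; last exact: aeW.
    have [At|At] := pselect (A theta = 0%R); last exact: aeW.
    have := hellinger_affinity_eq0_ae Pp (mq theta) (q0 theta).
    rewrite -(fineK (Afin theta)) -/(A theta) At => /(_ erefl).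
    by apply: filterS.
  by apply: filterS => x h theta; have := h (pickle theta); rewrite pickleK_inv.
have bound_ae : {ae P, forall x,
    bhattacharyya mu p (ptheta (that x)) <= K x + (L (that x))%:E}.
  apply: filterS2 pos_ae zero_ae => x [px qx] Az.
  have lnq0 : lne (ptheta theta0 x)%:E = (ln (ptheta theta0 x))%:E.
    by rewrite lne_EFin.
  have := mle x theta0; rewrite lnq0.
  (* The selected likelihood cannot vanish: its logarithm would be [-oo], below
     the finite penalized score of [theta0]. *)
  have [qhat0|qhat] := eqVneq (ptheta (that x) x) 0%R.
    by rewrite qhat0 le0_lneNy//= -EFinB leeNy_eq.
  have qhatpos : (0 < ptheta (that x) x)%R by rewrite lt_neqAle eq_sym qhat q0.
  rewrite lne_EFin// -!EFinB lee_fin => mlex.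
  have An0 : A (that x) != 0%R by apply/eqP => /Az /eqP; rewrite (negbTE qhat).
  have Apos : (0 < A (that x))%R by rewrite lt_neqAle eq_sym An0 A0.
  rewrite bhattacharyyaE//; last first.
    by rewrite -(fineK (Afin (that x))) eqe.
  rewrite -/(A (that x)) /K -EFinM -!EFinD lee_fin.
  apply: le_trans (log_affinity_bound (L (that x)) S0 Apos px qhatpos qx mlex) _.
  rewrite /k /W -/(c (that x)) le_eqVlt; apply/orP; left; apply/eqP.
  by field; rewrite gt_eqF// gt_eqF.
pose Lh x := (L (that x))%:E.
have mL : measurable_fun setT Lh.
  by apply: (measurable_selection (f := fun theta _ => (L theta)%:E)).
have mB : measurable_fun setT (fun x => bhattacharyya mu p (ptheta (that x))).
  by apply: (measurable_selection (f := fun theta _ => bhattacharyya mu p (ptheta theta))).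
have B0 x : 0 <= bhattacharyya mu p (ptheta (that x)).
  exact: bhattacharyya_ge0 Pp (Qq _).
have KL0 : {ae P, forall x, 0 <= K x + Lh x}.
  by apply: filterS bound_ae => x; exact: le_trans.
have iL : P.-integrable setT Lh.
  apply: integral_lty_integrable => //.
  have /integrableP[mK] := iK; apply: le_lt_trans.
  apply: ae_ge0_le_integral => //.
  - exact: measurable_funeneg.
  - exact: measurableT_comp.
  - apply: filterS KL0 => x + _.
    rewrite funenegE /K /Lh -EFinM -!EFinD abse_EFin ge_max !lee_fin.
    by rewrite normr_ge0 andbT => h; apply: le_trans (ler_norm _); lra.
split=> //.
have iKL : P.-integrable setT (K \+ Lh) by exact: integrableD.
apply: (@le_trans _ _ (\int[P]_x (K \+ Lh) x)); last first.
  by rewrite integralD// leeD2r.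
(* The bound is nonnegative only almost everywhere; its positive part is
   nonnegative everywhere and has the same integral. *)
rewrite [leRHS](ae_eq_integral (K \+ Lh)^\+)//; last 3 first.
- exact: (measurable_int _ iKL).
- exact/measurable_funepos/(measurable_int _ iKL).
- apply: filterS KL0 => x KLx _; rewrite funeposE.
  by apply/esym/max_idPl.
apply: ae_ge0_le_integral => //.
- exact/measurable_funepos/(measurable_int _ iKL).
- apply: filterS bound_ae => x h _; rewrite funeposE.
  by rewrite le_max h.
Qed.

Unset Implicit Arguments.
Set Strict Implicit.
Set Printing Implicit Defensive.

Theorem mainTheorem1 (d : measure_display) (T : measurableType d) (R : realType)
    (mu : {measure set T -> \bar R})
    (P : probability T R) (p : T -> R) (hp : is_density mu P p)
    (Theta : countType) (Ptheta : Theta -> probability T R)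
    (ptheta : Theta -> T -> R)
    (hptheta : forall theta, is_density mu (Ptheta theta) (ptheta theta))
    (pen : Theta -> R) (that : T -> Theta)
    (that_meas : forall theta, measurable (that @^-1` [set theta]))
    (that_mle : is_penalized_MLE ptheta pen that)
    (L : Theta -> R) :
  \int[P]_x bhattacharyya mu p (ptheta (that x)) <=
  minimal_expected_redundancy mu p ptheta pen
  +^ 2%:E * lne (\esum_(theta in [set: Theta])
                   (expR (- (1 / 2) * (pen theta + L theta)))%:E)
  +^ 'E_P[L \o that].
Proof.
have addy (x : \bar R) : x +^ +oo = +oo by case: x.
have yadd (x : \bar R) : +oo +^ x = +oo by [].
have addr (x : \bar R) (r : R) : x +^ r%:E = x + r%:E by case: x.
rewrite unlock.
have [Ey|] := eqVneq (\int[P]_x (L (that x))%:E) +oo.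
  by rewrite [X in _ +^ X]Ey addy leey.
rewrite -ltey => Ey.
set S := \esum_(theta in _) _.
have S0 : 0 <= S by apply: esum_ge0 => theta _; rewrite lee_fin expR_ge0.
have [Sy|] := eqVneq S +oo.
  rewrite Sy /= gt0_muley ?lte_fin// addy yadd; exact: leey.
rewrite -ltey => Sy.
have SE : S = (fine S)%:E by rewrite fineK// ge0_fin_numE.
(* If every relative entropy is [+oo] then so is the redundancy; otherwise one
   finite relative entropy makes the expectation of [L] finite. *)
rewrite /minimal_expected_redundancy; set D := (X in ereal_inf X).
have [[theta0 Dy]|noD] := pselect (exists theta0,
    relative_entropy mu p (ptheta theta0) < +oo); last first.
  suff -> : ereal_inf D = +oo by rewrite !yadd leey.
  apply/eqP; rewrite -leye_eq; apply/ereal_infP => _ [theta _ <-].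
  suff -> : relative_entropy mu p (ptheta theta) = +oo by [].
  by apply/eqP; rewrite -leye_eq leNgt; apply/negP => Dy; apply: noD; exists theta.
have main theta := expected_bhattacharyya_le hp hptheta that_meas that_mle SE Ey
  (theta0 := theta).
have [iL _] := main _ Dy.
have lneS : 2%:E * lne S = (2 * ln (fine S))%:E.
  by rewrite SE lne_EFin// -lte_fin -SE; exact: (esum_expR_gt0 _ theta0).
rewrite lneS; have := integrable_fin_num measurableT iL.
rewrite [X in _ +^ X](_ : _ = \int[P]_x (L (that x))%:E)//.
move: main; case: (\int[P]_x (L (that x))%:E) => //= e main _.
rewrite !addr.
rewrite -leeBlDr// -leeBlDr//; apply/ereal_infP => _ [theta _ <-].
rewrite leeBlDr// leeBlDr//.
have [Dthy|] := eqVneq (relative_entropy mu p (ptheta theta)) +oo.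
  by rewrite Dthy !addye// leey.
by rewrite -ltey => /main[].
Qed.
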